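(* Let $\mu\ge 0$ and $B\ge 0$, and let $p_{-\mu,B}$ and $\tilde p_{-\mu,B}$ be the pairwise constraints defined as follows: for $(x,f_x,g_x),(y,f_y,g_y)\in\mathbb{R}^d\times\mathbb{R}\times\mathbb{R}^d$, $$p_{-\mu,B}^{x,y}\ge 0\iff\begin{cases} f_y\ge f_x+\langle g_x,y-x\rangle-\frac{\mu}{2}\|x-y\|^2,\\ \|g_x\|\le B,\end{cases}$$ $$\tilde p_{-\mu,B}^{x,y}\ge 0\iff\begin{cases} f_y\ge f_x+\langle g_x,y-x\rangle-\frac{\mu}{2}\|x-y\|^2+\frac{\mu}{2}\|y-C_{xy}\|^2,\\ \|g_x\|\le B,\end{cases}$$ where $C_{xy}=\operatorname{argmin}\{\|z-y\|:\ z\in\mathbb{R}^d,\ \|\mu(x-z)+g_x\|\le B\}$. Then $\tilde p_{-\mu,B}$ is an interpolation constraint for $\mathcal{F}^m_{\tilde p_{-\mu,B}}(\mathbb{R}^d)$, and $\mathcal{F}^m_{\tilde p_{-\mu,B}}(\mathbb{R}^d)=\mathcal{F}^m_{p_{-\mu,B}}(\mathbb{R}^d)$, which is the class of $\mu$-weakly convex functions with subgradients bounded by $B$.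
   Context: Fix $d\ge 1$ and the Euclidean inner product and norm on $\mathbb{R}^d$. A pairwise constraint $p$ is a (possibly vector-valued) condition ''$p^{x,y}\ge 0$'' on ordered pairs of triplets $(x,f_x,g_x),(y,f_y,g_y)\in\mathbb{R}^d\times\mathbb{R}\times\mathbb{R}^d$. If $\|g_x\|>B$, $\tilde p_{-\mu,B}^{x,y}\ge 0$ is simply violated (so $C_{xy}$ is only needed when $\|g_x\|\le B$). For $\mu>0$, $C_{xy}$ is the projection of $y$ onto the ball of center $x+g_x/\mu$ and radius $B/\mu$; for $\mu=0$, $C_{xy}=y$. For $\mathcal{X}\subseteq\mathbb{R}^d$, a mapping $F=(f,g):\mathcal{X}\rightrightarrows\mathbb{R}\times\mathbb{R}^d$ assigns to each $x\in\mathcal{X}$ the nonempty set $F(x)=\{f(x)\}\times g(x)$, where $f(x)\in\mathbb{R}$ is single-valued and $g(x)\subseteq\mathbb{R}^d$ is nonempty and possibly multi-valued. $\mathrm{Graph}\,F=\{(x,F_x): x\in\mathcal{X},\ F_x\in F(x)\}$. $\mathcal{F}_p(\mathcal{X})$ is the set of mappings $F:\mathcal{X}\rightrightarrows\mathbb{R}\times\mathbb{R}^d$ such that $p\ge0$ holds at the ordered pair $((x_1,F_{x_1}),(x_2,F_{x_2}))$ for all $x_1,x_2\in\mathcal{X}$ and all $F_{x_i}\in F(x_i)$. $\mathcal{F}^m_p(\mathbb{R}^d)$ is the set of those $F\in\mathcal{F}_p(\mathbb{R}^d)$ for which there is no $\bar F\in\mathcal{F}_p(\mathbb{R}^d)$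 with $\mathrm{Graph}\,F\subsetneq\mathrm{Graph}\,\bar F$. When $\mathcal{X}$ is finite, mappings $F\in\mathcal{F}_p(\mathcal{X})$ are understood to have finite graph, i.e. they correspond to finite datasets $\{(x_i,f_i,g_i)\}$ (the same $x_i$ may appear with several $g_i$). $p$ is an interpolation constraint for $\mathcal{F}^m_p(\mathbb{R}^d)$ if for every finite $\mathcal{X}\subset\mathbb{R}^d$ and every $F\in\mathcal{F}_p(\mathcal{X})$ there exists $\bar F\in\mathcal{F}^m_p(\mathbb{R}^d)$ such that $F(x)\subseteq\bar F(x)$ for all $x\in\mathcal{X}$. A function $f:\mathbb{R}^d\to\mathbb{R}$ is $\mu$-weakly convex if $f+\frac{\mu}{2}\|\cdot\|^2$ is convex. The regular subdifferential $\partial f(x)$ is the set of $v\in\mathbb{R}^d$ with $f(y)\ge f(x)+\langle v,y-x\rangle+o(\|y-x\|)$ as $y\to x$. The class of $\mu$-weakly convex functions with subgradients bounded by $B$ is identified with the set of mappings $(f,\partial f)$ where $f:\mathbb{R}^d\to\mathbb{R}$ is $\mu$-weakly convex and $\|v\|\le B$ for all $x\in\mathbb{R}^d$, $v\in\partial f(x)$. *)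

(* Defs.v *)
From HB Require Import structures.
From mathcomp Require Import all_boot all_order all_algebra.
From mathcomp Require Import all_classical all_reals all_analysis.

Set Implicit Arguments.
Unset Strict Implicit.
Unset Printing Implicit Defensive.

Import Order.TTheory GRing.Theory Num.Theory.
Import numFieldNormedType.Exports.

Local Open Scope classical_set_scope.
Local Open Scope ring_scope.

(* The library norm [`|x|] on ['rV[R]_d] is the sup norm, so the Euclidean
   structure is defined here.  The topology (hence [nbhs]) is the same. *)
Definition dot (R : realType) (d : nat) (u v : 'rV[R]_d) : R :=
  \sum_(i < d) u 0 i * v 0 i.

Definition enorm (R : realType) (d : nat) (u : 'rV[R]_d) : R :=
  Num.sqrt (dot u u).

(* A triplet [(x, f_x, g_x)]. *)
Definition triplet (R : realType) (d : nat) : Type :=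
  ('rV[R]_d * R * 'rV[R]_d)%type.

Definition constraint (R : realType) (d : nat) : Type :=
  triplet R d -> triplet R d -> Prop.

(* The mapping [x |-> {mfun x} * mset x].  Both components are total: a mapping
   on [X] is used only through its values at the points of [X]. *)
Record mapping (R : realType) (d : nat) : Type := Mapping {
  mfun : 'rV[R]_d -> R ;
  mset : 'rV[R]_d -> set 'rV[R]_d }.

Definition graph (R : realType) (d : nat) (X : set 'rV[R]_d)
    (F : mapping R d) : set (triplet R d) :=
  [set t | let: (x, fx, gx) := t in [/\ X x, fx = mfun F x & mset F x gx]].

Definition Fclass (R : realType) (d : nat) (p : constraint R d)
    (X : set 'rV[R]_d) : set (mapping R d) :=
  [set F | (forall x, X x -> mset F x !=set0) /\
    (forall x1 x2 g1 g2, X x1 -> X x2 -> mset F x1 g1 -> mset F x2 g2 ->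
       p (x1, mfun F x1, g1) (x2, mfun F x2, g2))].

Definition Fmax (R : realType) (d : nat) (p : constraint R d) :
    set (mapping R d) :=
  [set F | Fclass p setT F /\
    ~ (exists2 F', Fclass p setT F' & graph setT F `<` graph setT F')].

Definition interpolation_constraint (R : realType) (d : nat)
    (p : constraint R d) : Prop :=
  forall (X : set 'rV[R]_d) (F : mapping R d),
    finite_set X -> Fclass p X F -> finite_set (graph X F) ->
    exists2 F', Fmax p F' &
      forall x, X x -> mfun F x = mfun F' x /\ mset F x `<=` mset F' x.

Definition argmin (R : realType) (T : Type) (A : set T) (h : T -> R) : set T :=
  [set z | A z /\ forall w, A w -> h z <= h w].

(* The point [C_xy].  When [enorm gx <= B] the minimizer exists and is unique
   (projection onto a nonempty closed convex set), so the default value 0 of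
   [xget] is then not used. *)
Definition Cpoint (R : realType) (d : nat) (mu B : R) (x gx y : 'rV[R]_d) :
    'rV[R]_d :=
  xget 0 (argmin [set z | enorm (mu *: (x - z) + gx) <= B]
                 (fun z => enorm (z - y))).

Definition p_wc (R : realType) (d : nat) (mu B : R) : constraint R d :=
  fun s t => let: (x, fx, gx) := s in let: (y, fy, _) := t in
    fx + dot gx (y - x) - mu / 2 * enorm (x - y) ^+ 2 <= fy /\ enorm gx <= B.

Definition pt_wc (R : realType) (d : nat) (mu B : R) : constraint R d :=
  fun s t => let: (x, fx, gx) := s in let: (y, fy, _) := t in
    fx + dot gx (y - x) - mu / 2 * enorm (x - y) ^+ 2
      + mu / 2 * enorm (y - Cpoint mu B x gx y) ^+ 2 <= fy /\ enorm gx <= B.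

Definition weakly_convex (R : realType) (d : nat) (mu : R)
    (f : 'rV[R]_d -> R) : Prop :=
  convex_function (setT : set (convex_lmodType 'rV[R]_d))
    (fun x => f x + mu / 2 * enorm x ^+ 2).

Definition regular_subdiff (R : realType) (d : nat) (f : 'rV[R]_d -> R)
    (x : 'rV[R]_d) : set 'rV[R]_d :=
  [set v | exists2 r : 'rV[R]_d -> R^o,
     r =o_ x (fun y => enorm (y - x) : R^o) &
     \forall y \near x, f x + dot v (y - x) + r y <= f y].

Definition weakly_convex_bounded (R : realType) (d : nat) (mu B : R) :
    set (mapping R d) :=
  [set F | [/\ weakly_convex mu (mfun F),
               mset F = regular_subdiff (mfun F) &
               forall x v, regular_subdiff (mfun F) x v -> enorm v <= B]].

(* Main.v *)
(* If every [x] carries a [g] with [|g| <= B] such that the paraboloid of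
   curvature [-mu] through [(x, f x)] with slope [g] lies below [f], then [f] is
   weakly convex and [B]-Lipschitz, and its regular subgradients are exactly the
   slopes of such paraboloids.  Together with Hahn-Banach (existence of slopes)
   this identifies the maximal mappings for [p] with the weakly convex functions.

   Globally [p] implies [pt]: bound [f] from below at [C] by the paraboloid, then
   move from [C] to [y] with the Lipschitz bound; by optimality of [C] the gradient
   of the paraboloid at [C] has norm [B] and is opposed to [y - C].

   For the interpolation, the left-hand side of [pt], as a function of [y], is
   supported at each [y] by the paraboloid with slope
   [mu *: (x - C_xy) + g], of norm at most [B]: this reduces to
   [dist^2 z >= dist^2 y + 2 <y - C_xy, z - y>] for the distance to a convex set.
   The maximum of these functions over the data interpolates. *)
Require Import Defs.
From mathcomp Require Import all_boot all_order all_algebra.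
From mathcomp Require Import all_classical all_reals all_analysis.
From mathcomp Require Import ring lra.
Set Implicit Arguments.
Unset Strict Implicit.
Unset Printing Implicit Defensive.
Import Order.TTheory GRing.Theory Num.Theory.
(* [Defs] again, because [mset] is shadowed by the libraries. *)
Import numFieldNormedType.Exports Defs.
Local Open Scope classical_set_scope.
Local Open Scope ring_scope.

(** * Euclidean inner product and norm *)

Section euclidean.
Context {R : realType} {d : nat}.
Implicit Types (u v w : 'rV[R]_d) (a : R).

Lemma dotC u v : dot u v = dot v u.
Proof. by apply: eq_bigr => i _; rewrite mulrC. Qed.

Lemma dotDl u v w : dot (u + v) w = dot u w + dot v w.
Proof. by rewrite -big_split; apply: eq_bigr => i _; rewrite mxE mulrDl. Qed.

Lemma dotZl a u v : dot (a *: u) v = a * dot u v.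
Proof. by rewrite mulr_sumr; apply: eq_bigr => i _; rewrite mxE mulrA. Qed.

Lemma dotNl u v : dot (- u) v = - dot u v.
Proof. by rewrite -scaleN1r dotZl mulN1r. Qed.

Lemma dotDr u v w : dot u (v + w) = dot u v + dot u w.
Proof. by rewrite dotC dotDl !(dotC _ u). Qed.

Lemma dotZr a u v : dot u (a *: v) = a * dot u v.
Proof. by rewrite dotC dotZl dotC. Qed.

Lemma dotNr u v : dot u (- v) = - dot u v.
Proof. by rewrite dotC dotNl dotC. Qed.

Lemma dot0l u : dot 0 u = 0.
Proof. by apply: big1 => i _; rewrite mxE mul0r. Qed.

Lemma dot0r u : dot u 0 = 0.
Proof. by rewrite dotC dot0l. Qed.

Definition dotE := (dotDl, dotDr, dotNl, dotNr, dotZl, dotZr).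

Lemma dot_ge0 u : 0 <= dot u u.
Proof. by apply: sumr_ge0 => i _; rewrite -expr2 sqr_ge0. Qed.

Lemma dot_eq0 u : dot u u = 0 -> u = 0.
Proof.
move=> u0; apply/rowP => i; rewrite mxE; apply/eqP; rewrite -sqrf_eq0 expr2.
move/eqP: u0; rewrite psumr_eq0 => [/allP/(_ i)|j _].
  by rewrite mem_index_enum => /(_ isT).
by rewrite -expr2 sqr_ge0.
Qed.

Lemma enorm_ge0 u : 0 <= enorm u.
Proof. exact: sqrtr_ge0. Qed.

Lemma enorm_sqr u : enorm u ^+ 2 = dot u u.
Proof. by rewrite sqr_sqrtr // dot_ge0. Qed.

Lemma enormZ a u : enorm (a *: u) = `|a| * enorm u.
Proof.
by rewrite /enorm dotZl dotZr mulrA -expr2 sqrtrM ?sqr_ge0 // sqrtr_sqr.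
Qed.

Lemma enormN u : enorm (- u) = enorm u.
Proof. by rewrite /enorm dotNl dotNr opprK. Qed.

Lemma enormB u v : enorm (u - v) = enorm (v - u).
Proof. by rewrite -opprB enormN. Qed.

Lemma enorm_eq0 u : enorm u = 0 -> u = 0.
Proof. by move=> u0; apply: dot_eq0; rewrite -enorm_sqr u0 expr0n. Qed.

Lemma enorm0 : enorm (0 : 'rV[R]_d) = 0.
Proof. by rewrite -(scale0r 0) enormZ normr0 mul0r. Qed.

Lemma enorm_gt0 u : u <> 0 -> 0 < enorm u.
Proof.
by move=> u0; rewrite lt_def enorm_ge0 andbT; apply/eqP => /enorm_eq0.
Qed.

Lemma dot_le_enorm u v : dot u v <= enorm u * enorm v.
Proof.
have [v0|/eqP v0] := eqVneq v 0.
  by rewrite v0 enorm0 mulr0 dot0r.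
have {}v0 := enorm_gt0 v0.
have [u0|/eqP/enorm_gt0 u0] := eqVneq u 0.
  by rewrite u0 enorm0 mul0r dot0l.
have := dot_ge0 (enorm v *: u - enorm u *: v).
rewrite !dotE (dotC v u) -!enorm_sqr => h.
rewrite -(ler_pM2l (mulr_gt0 u0 v0)) -subr_ge0 -(@pmulr_rge0 _ 2) //.
by congr (0 <= _): h; ring.
Qed.

Lemma dot_ge_enorm u v : - (enorm u * enorm v) <= dot u v.
Proof. by rewrite lerNl -dotNl -(enormN u) dot_le_enorm. Qed.

Lemma enorm_le_sqr u v : (enorm u <= enorm v) = (dot u u <= dot v v).
Proof. by rewrite -!enorm_sqr ler_pXn2r // nnegrE enorm_ge0. Qed.

Lemma enorm_triangle u v : enorm (u + v) <= enorm u + enorm v.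
Proof.
rewrite -(@ler_pXn2r _ 2) ?nnegrE ?addr_ge0 ?enorm_ge0 // sqrrD !enorm_sqr.
rewrite !dotE (dotC v u); have := dot_le_enorm u v; lra.
Qed.

Lemma continuous_dot (f g : 'rV[R]_d -> 'rV[R]_d) :
  continuous f -> continuous g -> continuous (fun x => dot (f x) (g x)).
Proof.
move=> cf cg; apply: continuous_big => [|i _ x]; first exact: add_continuous.
have c (h : 'rV[R]_d -> 'rV[R]_d) :
    continuous h -> {for x, continuous (fun y => h y 0 i)}.
  by move=> ch; exact: (cvg_comp _ _ (ch x) (@coord_continuous _ 1 d 0 i (h x))).
exact: (continuousM (c _ cf) (c _ cg)).
Qed.

(** Neighbourhoods come from the sup norm; continuity of [dot] makes Euclidean balls neighbourhoods
    too. *)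
Lemma enorm_cvg (x : 'rV[R]_d) (e : R) : 0 < e ->
  \forall y \near x, enorm (y - x) < e.
Proof.
move=> e0.
have c : continuous (fun y : 'rV[R]_d => dot (y - x) (y - x)).
  have cB : continuous (fun y : 'rV[R]_d => y - x).
    by move=> y; apply: continuousB => //; exact: cst_continuous.
  exact: (continuous_dot cB cB).
have {}c : (fun y : 'rV[R]_d => dot (y - x) (y - x)) @ x --> (0 : R).
  have -> : 0 = dot (x - x) (x - x) by rewrite subrr dot0l.
  exact: c.
have e2 : 0 < e ^+ 2 by rewrite exprn_gt0.
have /(_ (nbhs_filter x)) := cvgr_lt _ c _ e2; apply: filterS => y.
rewrite -enorm_sqr ltr_pXn2r // nnegrE ?enorm_ge0 //; exact: ltW.
Qed.

End euclidean.

(** * Hahn-Banach theorem in finite dimension *)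

Section hahn_banach.
Context {R : realType} {d : nat}.
Implicit Types u v : 'rV[R]_d.

Lemma dot_delta u i : dot u (delta_mx 0 i) = u 0 i.
Proof.
rewrite /dot (bigD1 i) //= mxE !eqxx mulr1 big1 ?addr0 // => j ji.
by rewrite mxE (negPf ji) andbF mulr0.
Qed.

(** Induction on the number of coordinates: a linear minorant on [V k], the vectors supported on the
    first [k] coordinates, is extended along the next basis vector [e]. *)
Lemma linear_le_convex (phi : 'rV[R]_d -> R) :
    phi 0 = 0 ->
    (forall u v t, 0 <= t <= 1 ->
       phi (t *: u + (1 - t) *: v) <= t * phi u + (1 - t) * phi v) ->
  exists a, forall u, dot a u <= phi u.
Proof.
move=> phi0 phi_convex.
pose V k u := forall i : 'I_d, (k <= i)%N -> u 0 i = 0.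
suff H k : exists a, forall u, V k u -> dot a u <= phi u.
  have [a Ha] := H d; exists a => u; apply: Ha => i.
  by rewrite leqNgt ltn_ord.
elim: k => [|k [a Ha]].
  exists 0 => u Vu; have -> : u = 0 by apply/rowP => i; rewrite Vu ?mxE.
  by rewrite dot0r phi0.
have [kd|dk] := ltnP k d; last first.
  exists a => u _; apply: Ha => i ki.
  by have := leq_trans dk ki; rewrite leqNgt ltn_ord.
pose i0 := Ordinal kd; pose e : 'rV[R]_d := delta_mx 0 i0.
(* The weights [p] and [1 - p] cancel [e], so that [Ha] applies to the convex combination. Every
   backward slope is thus at most every forward one, and the sup of the backward slopes separates
   them. *)
have key u v s t : V k u -> V k v -> 0 < s -> 0 < t ->
    (dot a u - phi (u - s *: e)) / s <= (phi (v + t *: e) - dot a v) / t.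
  move=> Vu Vv s0 t0; have st0 : 0 < s + t by rewrite addr_gt0.
  pose p := t / (s + t).
  have p01 : 0 <= p <= 1.
    apply/andP; split; first by rewrite divr_ge0 // ltW.
    by rewrite ler_pdivrMr // mul1r lerDr ltW.
  have pE : 1 - p = s / (s + t) by rewrite /p; field; lra.
  have Vw : V k (p *: u + (1 - p) *: v).
    by move=> i ki; rewrite !mxE Vu // Vv // !mulr0 addr0.
  have := phi_convex (u - s *: e) (v + t *: e) p p01.
  have -> : p *: (u - s *: e) + (1 - p) *: (v + t *: e) = p *: u + (1 - p) *: v.
    rewrite pE; apply/rowP => i; rewrite !mxE /p; field; lra.
  move=> /(le_trans (Ha _ Vw)); rewrite !dotE pE /p => h.
  rewrite ler_pdivrMr // mulrAC ler_pdivlMr //.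
  rewrite -subr_ge0 -(@pmulr_rge0 _ (s + t)^-1) ?invr_gt0 //.
  by rewrite -subr_ge0 in h; congr (0 <= _): h; field; lra.
pose A := [set c | exists u s,
  [/\ V k u, 0 < s & c = (dot a u - phi (u - s *: e)) / s]].
have V0 : V k 0 by move=> i _; rewrite mxE.
have A0 : A !=set0 by exists ((dot a 0 - phi (0 - 1 *: e)) / 1), 0, 1.
have Aub v t : V k v -> 0 < t -> ubound A ((phi (v + t *: e) - dot a v) / t).
  by move=> Vv t0 _ [u [s [Vu s0 ->]]]; exact: key.
pose c := sup A.
have c_ge v t : V k v -> 0 < t -> dot a v + t * c <= phi (v + t *: e).
  move=> Vv t0; have : c <= (phi (v + t *: e) - dot a v) / t.
    by apply: ge_sup => //; exact: Aub.
  by rewrite ler_pdivlMr // => h; lra.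
have c_le u s : V k u -> 0 < s -> dot a u - s * c <= phi (u - s *: e).
  move=> Vu s0; have : (dot a u - phi (u - s *: e)) / s <= c.
    apply: ub_le_sup; last by exists u, s.
    by exists ((phi (0 + 1 *: e) - dot a 0) / 1); exact: Aub.
  by rewrite ler_pdivrMr // => h; lra.
(* [Ha] leaves the [i0] coordinate of [a] free; it is reset to [c]. *)
exists (a + (c - a 0 i0) *: e) => u Vu.
pose w := u - u 0 i0 *: e.
have Vw : V k w.
  move=> i; rewrite leq_eqVlt => /orP[/eqP ki|ki].
    have -> : i = i0 by exact: val_inj.
    by rewrite !mxE !eqxx mulr1 subrr.
  rewrite !mxE (Vu i ki) sub0r; have -> : i == i0 = false.
    by apply/eqP => ii0; rewrite ii0 ltnn in ki.
  by rewrite andbF mulr0 oppr0.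
have uE : u = w + u 0 i0 *: e by rewrite subrK.
have -> : dot (a + (c - a 0 i0) *: e) u = dot a w + u 0 i0 * c.
  rewrite /w !dotE (dotC e u) !dot_delta; ring.
have [t0|t0|t0] := ltgtP (u 0 i0) 0.
- have := c_le w (- u 0 i0) Vw; rewrite oppr_gt0 => /(_ t0).
  by rewrite scaleNr opprK -uE mulNr opprK.
- by have := c_ge w _ Vw t0; rewrite -uE.
- by rewrite {2}uE t0 scale0r addr0 mul0r addr0; exact: Ha.
Qed.

End hahn_banach.

(** * Weak convexity, supporting paraboloids and regular subgradients *)

Section weakly_convex.
Context {R : realType} {d : nat}.
Implicit Types (mu t B : R) (f : 'rV[R]_d -> R) (x y z u v g : 'rV[R]_d).

(** Equivalently, [g + mu *: x] is a convex subgradient at [x] of [f + mu / 2 |.|^2]. *)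
Definition supports mu f x g :=
  forall y, f x + dot g (y - x) - mu / 2 * enorm (x - y) ^+ 2 <= f y.

Lemma weakly_convexP mu f : weakly_convex mu f <->
  forall x y t, 0 <= t <= 1 ->
    f (t *: x + (1 - t) *: y)
    <= t * f x + (1 - t) * f y + mu / 2 * (t * (1 - t)) * enorm (x - y) ^+ 2.
Proof.
have normE x y t : enorm (t *: x + (1 - t) *: y) ^+ 2 =
    t * enorm x ^+ 2 + (1 - t) * enorm y ^+ 2 - t * (1 - t) * enorm (x - y) ^+ 2.
  by rewrite !enorm_sqr !dotE (dotC y x); ring.
split=> [fc x y t t01|fc t x y _ _].
  have /andP[t0 t1] := t01.
  have := fc (Itv01 t0 t1) x y (mem_set I) (mem_set I).
  rewrite convRE /conv /= /unstable.onem normE => h; lra.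
have t01 : 0 <= t%:num <= 1 by apply/andP.
have := fc x y _ t01.
rewrite convRE /conv /= /unstable.onem normE => h; lra.
Qed.

(** In the support inequalities at the barycentre [z] towards [x] and [y], the weights [t] and
    [1 - t] cancel the linear terms. *)
Lemma supports_weakly_convex mu f :
  (forall x, exists g, supports mu f x g) -> weakly_convex mu f.
Proof.
move=> fs; apply/weakly_convexP => x y t /andP[t0 t1].
set z := _ + _; have [g gs] := fs z.
have := gs x; have := gs y; rewrite !enorm_sqr.
have -> : x - z = (1 - t) *: (x - y) by apply/rowP => i; rewrite !mxE; ring.
have -> : z - x = (t - 1) *: (x - y) by apply/rowP => i; rewrite !mxE; ring.
have -> : y - z = (- t) *: (x - y) by apply/rowP => i; rewrite !mxE; ring.
have -> : z - y = t *: (x - y) by apply/rowP => i; rewrite !mxE; ring.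
rewrite !(dotZl, dotZr); set D := dot (x - y) _; set G := dot g _.
move=> hy hx.
have {}t1 : 0 <= 1 - t by lra.
have := ler_wpM2l t0 hx; have := ler_wpM2l t1 hy; lra.
Qed.

(** Hahn-Banach for the increments of [f] at [x], made convex by adding [mu / 2 |u|^2]. *)
Lemma weakly_convex_supports mu f x :
  weakly_convex mu f -> exists g, supports mu f x g.
Proof.
move=> /weakly_convexP fc.
have [||a Ha] := @linear_le_convex R d
    (fun u => f (x + u) - f x + mu / 2 * enorm u ^+ 2).
- by rewrite addr0 enorm0; ring.
- move=> u v t t01; have := fc (x + u) (x + v) t t01.
  have -> : t *: (x + u) + (1 - t) *: (x + v) = x + (t *: u + (1 - t) *: v).
    by apply/rowP => i; rewrite !mxE; ring.
  have -> : x + u - (x + v) = u - v by rewrite opprD addrACA subrr add0r.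
  by rewrite !enorm_sqr !dotE (dotC v u) => h; lra.
exists a => y; have := Ha (y - x).
rewrite (addrC x) subrK (enormB x y); lra.
Qed.

Lemma supports_regular_subdiff mu f x g :
  supports mu f x g -> regular_subdiff f x g.
Proof.
move=> fs; exists (fun y => - (mu / 2 * enorm (x - y) ^+ 2)); last first.
  by apply: filterE => y; exact: fs.
apply/eqoP => e e0.
(* Within this radius the quadratic remainder is at most [e |y - x|]; the [+ 1] keeps the
   denominator positive. *)
have e1 : 0 < e / (`|mu / 2| + 1) by rewrite divr_gt0 // ltr_pwDr.
apply: filterS (enorm_cvg x e1) => y.
rewrite ltr_pdivlMr ?ltr_pwDr // => h.
rewrite normrN normrM normrX (enormB x y) (ger0_norm (enorm_ge0 _)).
rewrite expr2 mulrA ler_wpM2r ?enorm_ge0 //.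
have := enorm_ge0 (y - x); nra.
Qed.

(** Weak convexity along the segment carries the local inequality at [x] to [y]. For each [e] one
    small [t] is enough, since the factor [1 - t] left in the quadratic term is at most 1. *)
Lemma regular_subdiff_supports mu f x v : 0 <= mu ->
  weakly_convex mu f -> regular_subdiff f x v -> supports mu f x v.
Proof.
move=> hmu /weakly_convexP fc [r /eqoP ro fr] y.
have [->|/eqP yx] := eqVneq y x.
  by rewrite subrr dot0r enorm0; lra.
have D0 : 0 < enorm (y - x) by apply: enorm_gt0 => /subr0_eq.
set D := enorm (y - x) in D0.
apply/ler_addgt0Pl => e e0.
(* With this tolerance the remainder at distance [t * D] from [x] is at most [t * e], and division
   by [t] leaves [e]. *)
have eD0 : 0 < e / D by rewrite divr_gt0.
have lim : (fun t : R => x + t *: (y - x)) @ 0 --> x.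
  rewrite -[X in _ --> X]addr0 -(scale0r (y - x)).
  by apply: cvgD; [exact: cvg_cst|apply: cvgZl; exact: cvg_id].
have near0 := lim _ (filterI (ro _ eD0) fr).
have [t [t0 t1 [/= rt ft]]] : exists t : R, [/\ 0 < t, t <= 1 &
    `|r (x + t *: (y - x))| <= e / D * `|enorm (x + t *: (y - x) - x)| /\
    f x + dot v (x + t *: (y - x) - x) + r (x + t *: (y - x))
      <= f (x + t *: (y - x))].
  have [k /= k0 Hk] := near0.
  exists (Num.min 1 (k / 2)); split.
  - by rewrite lt_min ltr01 divr_gt0.
  - by rewrite ge_min lexx.
  - apply: Hk; rewrite /= sub0r normrN ger0_norm; last first.
      by rewrite le_min ler01 divr_ge0 // ltW.
    by rewrite gt_min ltr_pdivrMr // ltr_pMr // ltr1n orbT.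
have := fc y x t; rewrite (ltW t0) t1 => /(_ isT).
have -> : t *: y + (1 - t) *: x = x + t *: (y - x).
  by apply/rowP => i; rewrite !mxE; ring.
have xt : x + t *: (y - x) - x = t *: (y - x) by rewrite addrC addKr.
move: rt ft; rewrite xt enormZ dotZr -/D (enormB x y) -/D.
rewrite (gtr0_norm t0) (gtr0_norm (mulr_gt0 t0 D0)).
have -> : e / D * (t * D) = t * e by field; lra.
rewrite ler_norml => /andP[rt _] ft fxt.
rewrite -(ler_pM2l t0).
have := mulr_ge0 hmu (sqr_ge0 (t * D)); nra.
Qed.

Lemma supports_increment_le mu B f x y :
  (forall z, exists2 g, supports mu f z g & enorm g <= B) ->
  f y - f x <= B * enorm (y - x) + mu / 2 * enorm (y - x) ^+ 2.
Proof.
move=> fs; have [g gs gB] := fs y.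
have := gs x; have := dot_ge_enorm g (x - y).
rewrite (enormB x y).
have := enorm_ge0 (y - x); nra.
Qed.

(** Along [v] itself the paraboloid grows at rate [|v|] and [f] at rate at most [B], up to quadratic
    terms. *)
Lemma supports_bounded mu B f x v : 0 <= mu ->
  (forall z, exists2 g, supports mu f z g & enorm g <= B) ->
  supports mu f x v -> enorm v <= B.
Proof.
move=> hmu fs vs; rewrite leNgt; apply/negP => Bv.
have B0 : 0 <= B by have [g _] := fs x; apply: le_trans; exact: enorm_ge0.
have v0 : 0 < enorm v by exact: le_lt_trans Bv.
set n := enorm v in v0 Bv *.
(* Chosen so that [t * n * (mu + 1) = n - B], whereas the two bounds would force
   [n - B <= mu * (t * n)]. *)
pose t := (n - B) / ((mu + 1) * n).
have t0 : 0 < t by rewrite divr_gt0 ?subr_gt0 ?mulr_gt0 ?ltr_wpDl.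
have := supports_increment_le x (x + t *: v) fs.
have := vs (x + t *: v).
have -> : x + t *: v - x = t *: v by rewrite addrC addKr.
have -> : x - (x + t *: v) = - (t *: v) by rewrite opprD addrA subrr sub0r.
rewrite enormN dotZr enormZ -enorm_sqr.
rewrite (gtr0_norm t0).
rewrite -/n.
have tE : t * n * (mu + 1) = n - B by rewrite /t; field; lra.
move=> h1 h2.
have : t * n * (n - B) <= t * n * (mu * (t * n)) by nra.
rewrite (ler_pM2l (mulr_gt0 t0 v0)) -tE.
have := mulr_gt0 t0 v0; nra.
Qed.

(** Cutting the segment into [n] equal pieces divides the quadratic error of [supports_increment_le]
    by [n], and [n] can be taken arbitrarily large. *)
Lemma supports_lipschitz mu B f x y : 0 <= mu ->
  (forall z, exists2 g, supports mu f z g & enorm g <= B) ->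
  f y - f x <= B * enorm (y - x).
Proof.
move=> hmu fs; set D := enorm (y - x).
have D0 : 0 <= D by exact: enorm_ge0.
have step n : (0 < n)%N -> f y - f x <= B * D + mu / 2 * D ^+ 2 / n%:R.
  move=> n0; have nR : 0 < n%:R :> R by rewrite ltr0n.
  pose z k := x + (k%:R / n%:R) *: (y - x).
  have H k : f (z k) - f x <= k%:R * (B * (D / n%:R) + mu / 2 * (D / n%:R) ^+ 2).
    elim: k => [|k IH]; first by rewrite /z mul0r scale0r addr0 subrr mul0r.
    have := supports_increment_le (z k) (z k.+1) fs.
    have -> : z k.+1 - z k = n%:R^-1 *: (y - x).
      by apply/rowP => i; rewrite /z !mxE -natr1; ring.
    rewrite enormZ gtr0_norm ?invr_gt0 // (mulrC n%:R^-1) -/D -[k.+1%:R]natr1.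
    move: IH; lra.
  have := H n; rewrite /z divff ?gt_eqF // scale1r (addrC x) subrK.
  move/le_trans; apply; rewrite le_eqVlt; apply/orP; left; apply/eqP.
  by field; lra.
rewrite leNgt; apply/negP => h.
pose c := mu / 2 * D ^+ 2; pose e := f y - f x - B * D.
have e0 : 0 < e by rewrite subr_gt0.
have c0 : 0 <= c by rewrite mulr_ge0 ?divr_ge0 ?sqr_ge0.
have := step (Num.bound (c / e)).+1 isT; rewrite -/c -lerBlDl -/e.
rewrite ler_pdivlMr ?ltr0n // mulrC -ler_pdivlMr // leNgt => /negP; apply.
apply: lt_le_trans (archi_boundP _) _; first by rewrite divr_ge0 // ltW.
by rewrite ler_nat.
Qed.

End weakly_convex.

(** * Projection onto the feasible ball and the minorants given by [pt_wc] *)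

Section projection.
Context {R : realType} {d : nat}.
Implicit Types (mu t B : R) (x y z u v w g : 'rV[R]_d).

(** If the angle were acute, a small move from [z] towards [w] would come closer to [y]. *)
Lemma argmin_enorm_obtuse (A : set 'rV[R]_d) y z w :
    (forall u v t, A u -> A v -> 0 <= t <= 1 -> A ((1 - t) *: u + t *: v)) ->
    argmin A (fun z => enorm (z - y)) z -> A w ->
  dot (y - z) (w - z) <= 0.
Proof.
move=> Ac [Az zmin] Aw; rewrite leNgt; apply/negP; set P := dot _ _ => P0.
set W := dot (w - z) (w - z); have W0 : 0 <= W by exact: dot_ge0.
(* With this step [t * W <= P], whereas minimality of [z] gives [2 * P <= t * W]. *)
pose t := P / (P + W).
have t01 : 0 <= t <= 1.
  apply/andP; split; first by rewrite divr_ge0 ?addr_ge0 // ltW.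
  by rewrite ler_pdivrMr ?mul1r ?lerDl // ltr_wpDr.
have t0 : 0 < t by rewrite divr_gt0 // ltr_wpDr.
have tE : t * (P + W) = P by rewrite divfK // gt_eqF // ltr_wpDr.
have := zmin _ (Ac z w t Az Aw t01).
have -> : (1 - t) *: z + t *: w - y = t *: (w - z) - (y - z).
  by apply/rowP => i; rewrite !mxE; ring.
rewrite -(opprB y z) enorm_le_sqr !(dotDl (t *: _), dotDr _ (t *: _)).
rewrite !(dotNl, dotNr, dotZl, dotZr) opprK (dotC (w - z) (y - z)) -/P -/W.
move=> h.
have : 0 <= t * (t * W - 2 * P) by lra.
by rewrite pmulr_rge0 // => {}h; nra.
Qed.

Section Cpoint.
Variables (mu B : R) (x g : 'rV[R]_d).
Hypotheses (mu0 : 0 <= mu) (B0 : 0 <= B) (gB : enorm g <= B).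

Let A : set 'rV[R]_d := [set z | enorm (mu *: (x - z) + g) <= B].

(** The projection is explicit. The gradient of the paraboloid at [y] is [u]; if it is longer than
    [B], which forces [mu > 0], the witness moves [y] along [u] until the gradient shrinks to norm
    [B]. The triangle inequality shows that no shorter move is feasible. *)
Lemma Cpoint_argmin y : argmin A (fun z => enorm (z - y)) (Cpoint mu B x g y).
Proof.
apply: (xgetPex 0); set u := mu *: (x - y) + g.
have [uB|Bu] := leP (enorm u) B.
  by exists y; split=> // w _; rewrite subrr enorm0 enorm_ge0.
have mu1 : 0 < mu.
  rewrite lt_def mu0 andbT; apply: contraTneq Bu => m0.
  by rewrite /u m0 scale0r add0r -leNgt.
have u0 : 0 < enorm u by exact: le_lt_trans Bu.
exists (y + ((1 - B / enorm u) / mu) *: u); split=> [|w Aw].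
  rewrite /A /=.
  have -> : mu *: (x - (y + ((1 - B / enorm u) / mu) *: u)) + g
      = (B / enorm u) *: u.
    apply/rowP => i; rewrite [in RHS]/u !mxE; field.
    by rewrite !gt_eqF.
  by rewrite enormZ ger0_norm ?divr_ge0 ?enorm_ge0 // divfK // gt_eqF.
rewrite addrC addKr enormZ ger0_norm; last first.
  by rewrite divr_ge0 // subr_ge0 ler_pdivrMr // mul1r ltW.
have -> : (1 - B / enorm u) / mu * enorm u = (enorm u - B) / mu.
  by field; rewrite !gt_eqF.
rewrite ler_pdivrMr // mulrC -[mu in leRHS]ger0_norm // -enormZ.
have := enorm_triangle (mu *: (x - w) + g) (mu *: (w - y)).
have -> : mu *: (x - w) + g + mu *: (w - y) = u.
  by apply/rowP => i; rewrite !mxE; ring.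
move: Aw; rewrite /A /=; lra.
Qed.

Lemma Cpoint_feasible y : enorm (mu *: (x - Cpoint mu B x g y) + g) <= B.
Proof. by have [] := Cpoint_argmin y. Qed.

Lemma Cpoint_obtuse y w : enorm (mu *: (x - w) + g) <= B ->
  dot (y - Cpoint mu B x g y) (w - Cpoint mu B x g y) <= 0.
Proof.
move=> wB; apply: argmin_enorm_obtuse (Cpoint_argmin y) wB => u v t Au Av.
move=> /andP[t0 t1]; rewrite /A /=.
have -> : mu *: (x - ((1 - t) *: u + t *: v)) + g
    = (1 - t) *: (mu *: (x - u) + g) + t *: (mu *: (x - v) + g).
  by apply/rowP => i; rewrite !mxE; ring.
apply: le_trans (enorm_triangle _ _) _.
rewrite !enormZ (ger0_norm t0) ger0_norm ?subr_ge0 //.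
move: Au Av; rewrite /A /= => Au Av.
have t1' : 0 <= 1 - t by lra.
have := ler_wpM2l t0 Av; have := ler_wpM2l t1' Au; lra.
Qed.

Lemma Cpoint_id : Cpoint mu B x g x = x.
Proof.
have [_ /(_ x)] := Cpoint_argmin x; rewrite /A /= !subrr scaler0 add0r enorm0.
move=> /(_ gB) h; apply/subr0_eq/enorm_eq0/eqP.
by rewrite eq_le h enorm_ge0.
Qed.

(* [mu *: (x - C) + g] is the gradient at [C] of the paraboloid through
   [(x, g)]; off the feasible ball it has norm [B] and is opposed to [y - C]. *)
Lemma Cpoint_antiparallel y : 0 < mu ->
  dot (mu *: (x - Cpoint mu B x g y) + g) (y - Cpoint mu B x g y)
  <= - (B * enorm (y - Cpoint mu B x g y)).
Proof.
move=> mu1; set C := Cpoint mu B x g y.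
have [yC|/eqP/enorm_gt0 D0] := eqVneq (y - C) 0.
  by rewrite yC dot0r enorm0 mulr0 oppr0.
set D := enorm (y - C) in D0 *; set a : 'rV[R]_d := mu *: (x - C) + g.
(* The feasible point where the gradient is opposed to [y - C] with norm [B]. *)
pose w : 'rV[R]_d := C + mu^-1 *: (a + (B / D) *: (y - C)).
have wE : mu *: (x - w) + g = - ((B / D) *: (y - C)).
  by apply/rowP => i; rewrite /w /a !mxE; field; lra.
have wB : enorm (mu *: (x - w) + g) <= B.
  rewrite wE enormN enormZ ger0_norm ?divr_ge0 ?(ltW D0) // -/D.
  by rewrite divfK ?gt_eqF.
have := Cpoint_obtuse y wB; rewrite -/C /w (addrC C) addrK.
rewrite dotZr dotDr dotZr -enorm_sqr -/D (dotC _ a).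
rewrite pmulr_rle0 ?invr_gt0 //.
have -> : B / D * D ^+ 2 = B * D by field; lra.
lra.
Qed.

(** Where [y] is feasible this is the paraboloid itself; outside, the last term cancels its
    curvature along each outward normal ray of the ball. *)
Definition pt_minorant fx : 'rV[R]_d -> R := fun y =>
  fx + dot g (y - x) - mu / 2 * enorm (x - y) ^+ 2
    + mu / 2 * enorm (y - Cpoint mu B x g y) ^+ 2.

Lemma pt_minorant_id fx : pt_minorant fx x = fx.
Proof. by rewrite /pt_minorant Cpoint_id subrr dot0r enorm0; ring. Qed.

Lemma pt_minorant_supports fx y :
  supports mu (pt_minorant fx) y (mu *: (x - Cpoint mu B x g y) + g).
Proof.
move=> z; rewrite /pt_minorant.
have := Cpoint_obtuse y (Cpoint_feasible z).
move: (Cpoint mu B x g y) (Cpoint mu B x g z) => Cy Cz h.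
have h2 := dot_ge0 (z - Cz - (y - Cy)).
rewrite -subr_ge0 !enorm_sqr.
(* This is exactly the gap in the support inequality: a square, plus a term made nonnegative by the
   obtuse angle at [Cy]. *)
have : 0 <= mu / 2 * (dot (z - Cz - (y - Cy)) (z - Cz - (y - Cy))
   - 2 * dot (y - Cy) (Cz - Cy)).
  by rewrite mulr_ge0 ?divr_ge0 // subr_ge0 (le_trans _ h2) // pmulr_rle0.
congr (0 <= _); rewrite !dotE.
rewrite (dotC z y) (dotC x y) (dotC x z) (dotC Cy y) (dotC Cy z).
rewrite (dotC Cz y) (dotC Cz z) (dotC Cz Cy).
by field.
Qed.

End Cpoint.
End projection.

Lemma finite_argmax (R : realType) (T : choiceType) (A : set T) (h : T -> R) :
  finite_set A -> A !=set0 -> exists2 a, A a & forall b, A b -> h b <= h a.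
Proof.
move=> /finite_seqP[s ->{A}]; elim: s => [[?]//|a s IH _].
have [s0|s0] := pselect ([set` s] !=set0); last first.
  exists a => [|b]; rewrite /= ?inE ?eqxx //.
  by move=> /orP[/eqP -> //|bs]; case: s0; exists b.
have [c cs cmax] := IH s0; have [ac|ca] := leP (h a) (h c).
  exists c => [|b]; rewrite /= inE ?cs ?orbT //.
  by move=> /orP[/eqP -> //|]; exact: cmax.
exists a => [|b]; rewrite /= inE ?eqxx //.
by move=> /orP[/eqP -> //|/cmax /le_trans]; apply; exact: ltW.
Qed.

(** * Function classes, maximality and interpolation *)

Section classes.
Context {R : realType} {d : nat}.
Variables (mu B : R).
Hypotheses (mu0 : 0 <= mu) (B0 : 0 <= B).
Implicit Types (F : mapping R d).

Lemma Fclass_p_wcE F : Fclass (p_wc mu B) setT F <->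
  (forall x, mset F x !=set0) /\
  (forall x g, mset F x g -> supports mu (mfun F) x g /\ enorm g <= B).
Proof.
split=> [[F0 Fp]|[F0 Fs]]; split.
- by move=> x; exact: F0.
- move=> x g Fg; have [h Fh] := F0 x I; split=> [y|].
    by have [k Fk] := F0 y I; have [] := Fp _ _ _ _ I I Fg Fk.
  by have [] := Fp _ _ _ _ I I Fg Fh.
- by move=> x _; exact: F0.
- by move=> x y g h _ _ /Fs[gs gB] _; split.
Qed.

Lemma Fclass_supports F : Fclass (p_wc mu B) setT F ->
  forall z, exists2 g, supports mu (mfun F) z g & enorm g <= B.
Proof.
by move=> /Fclass_p_wcE[F0 Fs] z; have [g /Fs[]] := F0 z; exists g.
Qed.

(** One inclusion holds because the added square is nonnegative. The other uses the value of the
    mapping at [C], available because the domain is the whole space. *)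
Lemma Fclass_pt_wcE : Fclass (pt_wc mu B) setT = Fclass (@p_wc R d mu B) setT.
Proof.
apply/seteqP; split=> F [F0 Fp]; split=> // x y g h _ _ Fg Fh.
  have [le1 gB] := Fp x y g h I I Fg Fh; split=> //.
  apply: le_trans le1; rewrite lerDl mulr_ge0 ?divr_ge0 // exprn_ge0 //.
  exact: enorm_ge0.
have [le1 gB] := Fp x y g h I I Fg Fh; split=> //.
have [m0|mu1] : mu = 0 \/ 0 < mu.
  by have [|m0] := eqVneq mu 0; [left|right; rewrite lt_def m0].
  by move: le1; rewrite m0; lra.
have Fc : Fclass (p_wc mu B) setT F by split.
set C := Cpoint mu B x g y.
have := supports_lipschitz y C mu0 (Fclass_supports Fc).
have [k Fk] := F0 C I; have [le2 _] := Fp x C g k I I Fg Fk.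
have := Cpoint_antiparallel x mu0 B0 gB y mu1; rewrite /= -/C.
rewrite (enormB C y); move: le2; rewrite !enorm_sqr !dotE.
rewrite (dotC x y) (dotC C x) (dotC C y); lra.
Qed.

Lemma Fmax_pt_wcE : Fmax (pt_wc mu B) = Fmax (@p_wc R d mu B).
Proof. by rewrite /Fmax Fclass_pt_wcE. Qed.

(** The largest candidate over a given [f]: by [mset_sub_subdiff] it contains the slopes of every
    mapping of the class with that function. *)
Definition subdiff_mapping (f : 'rV[R]_d -> R) : mapping R d :=
  Mapping f (regular_subdiff f).

Lemma weakly_convex_bounded_subdiff F : Fclass (p_wc mu B) setT F ->
  weakly_convex_bounded mu B (subdiff_mapping (mfun F)).
Proof.
move=> Fc; have Fs := Fclass_supports Fc.
have wc : weakly_convex mu (mfun F).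
  by apply: supports_weakly_convex => x; have [g] := Fs x; exists g.
split=> //= x v /(regular_subdiff_supports mu0 wc).
exact: supports_bounded.
Qed.

Lemma mset_sub_subdiff F x : Fclass (p_wc mu B) setT F ->
  mset F x `<=` regular_subdiff (mfun F) x.
Proof.
by move=> /Fclass_p_wcE[_ Fs] g /Fs[gs _]; exact: supports_regular_subdiff gs.
Qed.

Lemma weakly_convex_bounded_Fclass F :
  weakly_convex_bounded mu B F -> Fclass (p_wc mu B) setT F.
Proof.
move=> [wc FE Fb]; apply/Fclass_p_wcE; rewrite FE; split=> [x|x g gs].
  have [g gs] := weakly_convex_supports x wc.
  by exists g; exact: supports_regular_subdiff gs.
by split; [exact: regular_subdiff_supports|exact: Fb gs].
Qed.

(** A missing regular subgradient would make [subdiff_mapping] a strictly larger member of the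
    class. Conversely, nonempty slope sets force a larger graph to keep the same function, all of
    whose regular subgradients are already present. *)
Lemma Fmax_p_wcE : Fmax (p_wc mu B) = @weakly_convex_bounded R d mu B.
Proof.
apply/seteqP; split=> F.
  move=> [Fc Fm]; have wcb := weakly_convex_bounded_subdiff Fc.
  have [wc _ Fb] := wcb; split=> //.
  apply/funext => x; apply/seteqP; split; first exact: mset_sub_subdiff.
  move=> g gx; apply: contrapT => Fxg; apply: Fm.
  exists (subdiff_mapping (mfun F)); first exact: weakly_convex_bounded_Fclass.
  split.
    move=> [[y fy] h] [_ /= -> Fh]; split=> //=; exact: mset_sub_subdiff Fc _ Fh.
  by move=> /(_ (x, mfun F x, g))[].
move=> wcb; have Fc := weakly_convex_bounded_Fclass wcb; split=> //.
have [wc FE Fb] := wcb.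
move=> [G Gc [FG]]; apply.
have fE : mfun F = mfun G.
  apply/funext => x; have [g Fg] := Fc.1 x I.
  by have [] := FG (x, mfun F x, g) (And3 I erefl Fg).
move=> [[x fx] g] [_ /= -> Gg]; split; rewrite ?fE //= FE fE.
exact: mset_sub_subdiff Gg.
Qed.

Lemma pt_wc_interpolation : interpolation_constraint (@pt_wc R d mu B).
Proof.
move=> X F _ [F0 Fp] finT.
(* Once such an [f] is found, its full subdifferential gives a maximal mapping. *)
suff [f fs fX] : exists2 f,
    (forall y, exists2 g, supports mu f y g & enorm g <= B) &
    forall x v, X x -> mset F x v -> mfun F x = f x /\ supports mu f x v.
  pose G := Mapping f (fun x => [set g | supports mu f x g /\ enorm g <= B]).
  have Gc : Fclass (p_wc mu B) setT G.
    by apply/Fclass_p_wcE; split=> [x|x g //]; have [g] := fs x; exists g.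
  exists (subdiff_mapping f).
    by rewrite Fmax_pt_wcE Fmax_p_wcE; exact: weakly_convex_bounded_subdiff Gc.
  move=> x Xx; split; first by have [v /(fX _ _ Xx)[]] := F0 x Xx.
  by move=> v /(fX _ _ Xx)[_]; exact: supports_regular_subdiff.
have TB s : graph X F s -> enorm s.2 <= B.
  by case: s => [[x fx] g] /= [Xx _ Fg]; have [] := Fp x x g g Xx Xx Fg Fg.
(* Without data, the zero function does, with slope 0 everywhere. *)
have [T0|T0] := pselect (graph X F !=set0); last first.
  exists (fun=> 0) => [y|x v Xx Fv]; last first.
    by case: T0; exists (x, mfun F x, v).
  exists 0; rewrite ?enorm0 // => z.
  by rewrite dot0l add0r sub0r oppr_le0 mulr_ge0 ?divr_ge0 ?sqr_ge0.
pose Q (s : triplet R d) := pt_minorant mu B s.1.1 s.2 s.1.2.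
(* [a y] is a datum whose minorant is active at [y]. *)
have /boolp.choice[a aP] y : exists a, graph X F a /\
    forall s, graph X F s -> Q s y <= Q a y.
  by have [a Ta am] := finite_argmax (fun s => Q s y) finT T0; exists a.
pose f y := Q (a y) y.
have fge s y : graph X F s -> Q s y <= f y by exact: (aP y).2.
have Qs s y : graph X F s ->
    supports mu (Q s) y (mu *: (s.1.1 - Cpoint mu B s.1.1 s.2 y) + s.2).
  by move=> /TB sB; exact: pt_minorant_supports.
(* The minorant active at [y] lies below [f] and touches it there, so its slope supports [f]. *)
exists f => [y|x v Xx Fv].
  have Ty := (aP y).1; eexists.
    by move=> z; apply: le_trans (Qs _ _ Ty z) (fge _ _ Ty).
  exact: Cpoint_feasible (TB _ Ty) _.
have Tx : graph X F (x, mfun F x, v) by [].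
have vB := TB _ Tx.
have Qx : Q (x, mfun F x, v) x = mfun F x by exact: pt_minorant_id.
(* The minorant of the datum at [x] gives [<=]; the constraint from the active datum to [x] gives
   the converse. *)
have fxE : mfun F x = f x.
  apply/le_anti/andP; split; first by have := fge _ x Tx; rewrite Qx.
  rewrite /f; have := (aP x).1; case: (a x) => [[x' f'] g'] /= [Xx' -> Fg'].
  by have [] := Fp x' x g' v Xx' Xx Fg' Fv.
split=> // z; apply: le_trans (fge _ z Tx).
(* At [x] itself [C = x], so the supporting slope of this minorant is [v]. *)
have := Qs _ x Tx z; rewrite /= Cpoint_id // subrr scaler0 add0r Qx.
by rewrite fxE.
Qed.

End classes.

Theorem theorem2 (R : realType) (d : nat) (mu B : R)
    (hd : (0 < d)%N) (hmu : 0 <= mu) (hB : 0 <= B) :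
  [/\ interpolation_constraint (pt_wc (R:=R) (d:=d) mu B),
      Fmax (pt_wc (R:=R) (d:=d) mu B) = Fmax (p_wc (R:=R) (d:=d) mu B) &
      Fmax (p_wc (R:=R) (d:=d) mu B)
        = weakly_convex_bounded (R:=R) (d:=d) mu B].
Proof.
split.
- exact: (pt_wc_interpolation hmu hB).
- exact: (@Fmax_pt_wcE R d mu B hmu hB).
- exact: (@Fmax_p_wcE R d mu B hmu).
Qed.
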